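(* Let $t_0\in\mathbb{R}$, let $\ell_1\in V_{t_0}$ and let there exist $\kappa>0$ such that $$\ell_0(v)(t)+f(v)(t)\ge0\quad\text{for a.e. }t\le t_0\text{ and every }v\in C_0(\mathbb{R};[0,\kappa]).$$ Let, moreover, there exist $\gamma\in AC_{loc}((-\infty,t_0];(0,+\infty))$ such that $\gamma'(t)\le-\ell_1(\gamma)(t)$ for a.e. $t\le t_0$ and $\gamma(-\infty)<+\infty$. Then every solution $u$ to $u'(t)=\ell_0(u)(t)-\ell_1(u)(t)+f(u)(t)$ on $(-\infty,t_0]$ satisfying $0\le u(t)\le\kappa$ for $t\le t_0$ has a finite limit $u(-\infty)$.
   Context: Notation. $\mathbb{R}_+=[0,+\infty)$. $C_{loc}(\mathbb{R};\mathbb{R})$ is the space of continuous functions $\mathbb{R}\to\mathbb{R}$ with the topology of uniform convergence on every compact interval. $L_{loc}(\mathbb{R};\mathbb{R})$ is the space of locally Lebesgue-integrable functions on $\mathbb{R}$ with the topology of convergence in the mean on every compact interval. For $I,D\subseteq\mathbb{R}$: $C_0(I;D)$ is the set of bounded continuous functions $I\to D$; $AC_{loc}(I;D)$ is the set of functions $I\to D$ absolutely continuous on every compact interval contained in $I$; $L_{loc}(\mathbb{R};\mathbb{R}_+)$ is the set of functions $\mathbb{R}\to\mathbb{R}_+$ integrable on every compact interval. $u(-\infty)$ denotes the (finite or infinite) limit of $u$ at $-\infty$, if it exists. Standing assumptions. $\ell_0,\ell_1:C_{loc}(\mathbb{R};\mathbb{R})\to L_{loc}(\mathbb{R};\mathbb{R})$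 are linear continuous operators which are positive (map non-negative functions to non-negative functions). $f:C_{loc}(\mathbb{R};\mathbb{R})\to L_{loc}(\mathbb{R};\mathbb{R})$ is a continuous operator satisfying the local Carathéodory conditions: for every $r>0$ there is $q_r\in L_{loc}(\mathbb{R};\mathbb{R}_+)$ with $|f(v)(t)|\le q_r(t)$ for a.e. $t\in\mathbb{R}$ whenever $\sup_{\mathbb{R}}|v|\le r$. If $I\subseteq\mathbb{R}$ is a closed interval, $u:I\to\mathbb{R}$ is continuous and $T:C_{loc}(\mathbb{R};\mathbb{R})\to L_{loc}(\mathbb{R};\mathbb{R})$ is a continuous operator, then $T(u):=T(\vartheta(u))$, where $\vartheta(u)$ is the extension of $u$ to $\mathbb{R}$ equal to $u(\inf I)$ to the left of $I$ (if $\inf I>-\infty$) and $u(\sup I)$ to the right of $I$ (if $\sup I<+\infty$). For $\tau\in\mathbb{R}$, $V_\tau$ is the set of continuous operators $T:C_{loc}(\mathbb{R};\mathbb{R})\to L_{loc}(\mathbb{R};\mathbb{R})$ such that for every $\zeta\le\tau$, $T(u)(t)=T(v)(t)$ for a.e. $t\le\zeta$ whenever $u,v\in C_{loc}(\mathbb{R};\mathbb{R})$ and $u=v$ on $(-\infty,\zeta]$. A solution of the equation on a closed interval $I$ is a function $u:I\to\mathbb{R}$ absolutely continuous on every compact interval contained in $I$ and satisfying the equation a.e. on $I$ (with $\ell_0(u),\ell_1(u),f(u)$ understood via the extension $\vartheta(u)$). *)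

(* Defs.v *)
From mathcomp Require Import all_boot all_order all_algebra.
From mathcomp Require Import all_classical all_reals all_analysis.

Set Implicit Arguments.
Unset Strict Implicit.
Unset Printing Implicit Defensive.

Import Order.TTheory GRing.Theory Num.Theory.
Import numFieldNormedType.Exports.

Local Open Scope classical_set_scope.
Local Open Scope ring_scope.

Section Spaces.
Context {R : realType}.
Local Notation mu := (@lebesgue_measure R).

Definition C_loc : set (R -> R) := [set v | continuous v].

(* Elements of L_loc are classes modulo almost-everywhere equality; they are
   handled through representatives, and all statements about them are
   almost-everywhere statements.  [locally_integrable] asks for a Borel
   measurable representative, which every class has. *)
Definition L_loc : set (R -> R) := [set g | locally_integrable setT g].

Definition L_loc_nneg : set (R -> R) :=
  [set g | L_loc g /\ forall t, 0 <= g t].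

(* A function on I is represented by a total function R -> R of which only
   the values on I matter. *)
Definition C_0 (I D : set R) : set (R -> R) :=
  [set v | [/\ {within I, continuous v}, [bounded v t | t in I] &
               forall t, I t -> D (v t)]].

Definition abs_continuous (a b : R) (u : R -> R) : Prop :=
  forall e : R, 0 < e -> exists2 d : R, 0 < d &
    forall (n : nat) (x y : 'I_n -> R),
      (forall i, a <= x i /\ x i <= y i /\ y i <= b) ->
      trivIset setT (fun i => `]x i, y i[%classic) ->
      \sum_(i < n) (y i - x i) < d ->
      \sum_(i < n) `|u (y i) - u (x i)| < e.

Definition AC_loc (I D : set R) : set (R -> R) :=
  [set u | (forall t, I t -> D (u t)) /\
           forall a b : R, `[a, b]%classic `<=` I -> abs_continuous a b u].

(* An operator C_loc -> L_loc is a map on all functions of which only the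
   values on C_loc matter.  The topology of C_loc is induced by that of
   uniform convergence on compact sets, and the topology of L_loc is given by
   the seminorms g |-> \int_[a, b] |g|. *)
Definition continuous_operator (T : (R -> R) -> (R -> R)) : Prop :=
  (forall v, C_loc v -> L_loc (T v)) /\
  forall u, C_loc u -> forall a b : R,
    (\int[mu]_(t in `[a, b]) (`|T v t - T u t|)%:E)%E
      @[v --> within C_loc (nbhs (u : {family compact, R -> R}))] --> 0%E.

Definition linear_operator (T : (R -> R) -> (R -> R)) : Prop :=
  forall (c : R) (u v : R -> R), C_loc u -> C_loc v ->
    \forall t \ae mu, T (fun s => c * u s + v s) t = c * T u t + T v t.

Definition positive_operator (T : (R -> R) -> (R -> R)) : Prop :=
  forall v, C_loc v -> (forall t, 0 <= v t) -> \forall t \ae mu, 0 <= T v t.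

Definition local_caratheodory (f : (R -> R) -> (R -> R)) : Prop :=
  forall r : R, 0 < r -> exists2 q : R -> R, L_loc_nneg q &
    forall v, C_loc v -> (forall t, `|v t| <= r) ->
      \forall t \ae mu, `|f v t| <= q t.

Definition V (tau : R) (T : (R -> R) -> (R -> R)) : Prop :=
  continuous_operator T /\
  forall zeta : R, zeta <= tau -> forall u v, C_loc u -> C_loc v ->
    (forall t, t <= zeta -> u t = v t) ->
    \forall t \ae mu, t <= zeta -> T u t = T v t.

(* For a nonempty closed interval I, the endpoints [inf I] and [sup I] are
   only used when they are finite. *)
Definition theta (I : set R) (u : R -> R) : R -> R := fun t =>
  if t \in I then u t
  else if `[< lbound I t >] then u (inf I)
  else u (sup I).

Definition solution (l0 l1 f : (R -> R) -> (R -> R)) (I : set R)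
    (u : R -> R) : Prop :=
  AC_loc I setT u /\
  \forall t \ae mu, I t -> derivable u t 1 /\
    u^`()%classic t = l0 (theta I u) t - l1 (theta I u) t + f (theta I u) t.

End Spaces.

(* Main.v *)
Require Import Defs.
From mathcomp Require Import all_boot all_order all_algebra.
From mathcomp Require Import all_classical all_reals all_analysis.
From mathcomp Require Import lra.

Import Order.TTheory GRing.Theory Num.Theory.
Import numFieldNormedType.Exports.

Local Open Scope classical_set_scope.
Local Open Scope ring_scope.

(** The function [gamma] dominates [u] up to a constant. As [l1] is positive,
[gamma' <= - l1 gamma <= 0], so [gamma] is nonincreasing and stays above
[gamma t0 > 0] on the half-line, and [k u <= gamma] there for
[k = gamma t0 / kappa]. Positivity and linearity of [l1] then give
[k (l1 u) <= l1 gamma <= - gamma'], while [l0 u + f u >= 0] because the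
extension of [u] takes its values in [[0, kappa]]. Together,
[k u' >= - k (l1 u) >= gamma']: the function [k u - gamma] has a nonnegative
derivative almost everywhere. It is absolutely continuous, so it is
nondecreasing; it is bounded below because [u >= 0] and [gamma] has a finite
limit, so it converges at [-oo], and [u], a linear combination of it and
[gamma], converges too.

The analytic core is [ac_nondecreasing]: an absolutely continuous function
whose derivative is almost everywhere nonnegative is nondecreasing. It is proved
without integration. The points where the derivative fails to be nonnegative
are covered by an open set [U] of small measure. From the left end of the
interval one advances by real induction, either inside [U] or past a point of
differentiability. Absolute continuity bounds the total decrease over the
steps of the first kind, and each step of the second kind decreases the
function by at most [e] times its length ([fall_controlled]). *)

Set Implicit Arguments.
Unset Strict Implicit.

(** * Real induction and local estimates *)

(** Compactness of [[a, b]] in the form of an induction principle: the supremum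
of the points reached so far is itself reached by a left step, and a right step
would then go beyond it unless it is [b]. *)
Lemma real_induction (R : realType) (P : R -> Prop) (a b : R) : a <= b -> P a ->
  (forall t, a <= t <= b -> exists2 d, 0 < d &
    (forall p, a <= p <= t -> t - d < p -> P p -> P t) /\
    (forall q, t <= q <= b -> q < t + d -> P t -> P q)) ->
  P b.
Proof.
move=> ab Pa step; pose S := [set p | a <= p <= b /\ P p].
have Sa : S a by split=> //; rewrite lexx.
have supS : has_sup S by split; [exists a | exists b => p [/andP[]]].
have aS : a <= sup S by apply: ub_le_sup => //; case: supS.
have Sb : sup S <= b by apply: ge_sup; [exists a | move=> p [/andP[]]].
have [d d0 [left_step right_step]] := step (sup S) (introT andP (conj aS Sb)).
have [p [/andP[ap pb] Pp] sp] := sup_adherent d0 supS.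
have pS : p <= sup S by apply: ub_le_sup; [case: supS | split=> //; apply/andP].
have PS : P (sup S) by apply: (left_step p) => //; apply/andP.
have [Sltb|] := ltP (sup S) b; last first.
  by move=> bS; have -> : b = sup S by apply/eqP; rewrite eq_le bS Sb.
pose q := Num.min b (sup S + d / 2).
have Sq : sup S < q by rewrite /q lt_min Sltb/= ltrDl divr_gt0.
have qb : q <= b by rewrite /q ge_min lexx.
have qd : q < sup S + d.
  by apply: (@le_lt_trans _ _ (sup S + d / 2)); [rewrite /q ge_min lexx orbT | lra].
have Pq : P q by apply: right_step => //; rewrite qb ltW.
have : q <= sup S.
  apply: ub_le_sup; first by case: supS.
  by split=> //; rewrite qb (le_trans aS)// ltW.
by rewrite leNgt Sq.
Qed.

(** The comparison holds only between [t] and its neighbours, not between two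
neighbours of [t]; this is all that [real_induction] asks for. *)
Lemma derive_ge0_almost_nondecreasing (R : realType) (g : R -> R) (t e : R) :
  0 < e -> derivable g t 1 -> 0 <= g^`()%classic t ->
  exists2 d, 0 < d &
    (forall p, t - d < p -> p <= t -> g p <= g t + e * (t - p)) /\
    (forall q, t <= q -> q < t + d -> g t <= g q + e * (q - t)).
Proof.
move=> e0 dg g'0.
have : h^-1 *: (g (h *: 1 + t) - g t) @[h --> 0^'] --> g^`()%classic t.
  by rewrite derive1E; exact: dg.
move=> /cvgrPdist_lt/(_ e e0)/nbhs_ballP[d /= d0 near0].
have slope (h : R) : h != 0 -> `|h| < d -> - e < h^-1 * (g (t + h) - g t).
  move=> h0 hd; have := near0 h; rewrite /ball/= sub0r normrN => /(_ hd h0).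
  rewrite /GRing.scale/= mulr1 (addrC h) => /ltr_distlBl; apply: le_lt_trans.
  by rewrite lerBrDr addNr.
exists d => //; split.
- move=> p tp pt; have [->|npt] := eqVneq p t; first by rewrite subrr mulr0 addr0.
  have ptlt : p < t by rewrite lt_neqAle npt.
  have := slope (p - t); rewrite subr_eq0 npt ltr0_norm ?subr_lt0// opprB.
  rewrite subrKC => /(_ isT); rewrite ltrBlDr -ltrBlDl => /(_ tp).
  rewrite mulrC ltr_ndivlMr ?subr_lt0//; lra.
- move=> q tq qt; have [->|nqt] := eqVneq q t; first by rewrite subrr mulr0 addr0.
  have qtlt : t < q by rewrite lt_neqAle eq_sym nqt.
  have := slope (q - t); rewrite subr_eq0 nqt gtr0_norm ?subr_gt0//.
  rewrite subrKC => /(_ isT); rewrite ltrBlDl => /(_ qt).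
  rewrite mulrC ltr_pdivlMr ?subr_gt0//; lra.
Qed.

(** * Null sets and total lengths *)

Lemma negligible_open_cover (R : realType) (E : set R) (d : R) : 0 < d ->
  (@lebesgue_measure R).-negligible E ->
  exists2 U : set R, open U & E `<=` U /\ (lebesgue_measure U < d%:E)%E.
Proof.
move=> d0 [B [mB B0 EB]].
have [|U [oU BU Ud]] := lebesgue_regularity_outer mB _ d0; first by rewrite [ltLHS]B0 ltry.
exists U => //; split; first exact: subset_trans BU.
have mU : measurable U by exact: measurable_realfun.open_measurable.
have -> : U = (U `\` B) `|` B by rewrite setDKU.
rewrite (le_lt_trans (measureU2 _ _ _))//; first exact: measurableD.
by rewrite [X in (_ + X)%E]B0 adde0.
Qed.

(** Turns a bound on the measure of [U] into the bound on total length that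
absolute continuity requires of a disjoint family of intervals in [U]. *)
Lemma sum_length_le_measure (R : realType) (n : nat) (x y : 'I_n -> R)
    (U : set R) : measurable U ->
  (forall i, x i <= y i) -> (forall i, `]x i, y i[ `<=` U) ->
  trivIset setT (fun i => `]x i, y i[%classic) ->
  ((\sum_(i < n) (y i - x i))%:E <= lebesgue_measure U)%E.
Proof.
move=> mU xy xyU tI.
rewrite (_ : _%:E = (\sum_(i < n) lebesgue_measure `]x i, y i[%classic)%E); last first.
  rewrite -sumEFin; apply: eq_bigr => i _.
  rewrite lebesgue_measure_itv/= lte_fin; case: ltP => // yx.
  by congr _%:E; apply/eqP; rewrite subr_eq0 eq_le yx xy.
rewrite -(@measure_bigsetU_ord _ _ _ _ _ xpredT)//.
apply: le_measure; rewrite ?inE//.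
- by apply: bigsetU_measurable => i _; exact: measurable_itv.
- by elim/big_ind: _ => // A B AU BU z [/AU|/BU].
Qed.

(** * Absolutely continuous functions with nonnegative derivative *)

(** The invariant of the real induction: between [a] and [c], [g] falls by at
most slope [e] plus its variation over finitely many disjoint intervals inside
the exceptional set [U]. The family is kept explicit, in the format of
[abs_continuous], so that absolute continuity applies to it once [c] has reached
the right end. *)
Definition fall_controlled (R : realType) (U : set R) (e : R) (g : R -> R)
    (a c : R) : Prop :=
  exists (n : nat) (x y : 'I_n -> R),
    [/\ forall i, a <= x i /\ x i <= y i /\ y i <= c,
        forall i, `]x i, y i[ `<=` U,
        trivIset setT (fun i => `]x i, y i[%classic) &
        g a <= g c + e * (c - a) + \sum_(i < n) `|g (y i) - g (x i)|].

Lemma fall_controlled_refl (R : realType) (U : set R) (e : R) (g : R -> R)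
    (a : R) : fall_controlled U e g a a.
Proof.
exists 0%N, (fun=> a), (fun=> a); split; [by case | by case | by case |].
by rewrite big_ord0 subrr mulr0 !addr0.
Qed.

Lemma fall_controlled_slope (R : realType) (U : set R) (e : R) (g : R -> R)
    (a p q : R) : p <= q -> g p <= g q + e * (q - p) ->
  fall_controlled U e g a p -> fall_controlled U e g a q.
Proof.
move=> pq gpq [n [x [y [xy xyU tI gap]]]]; exists n, x, y; split=> //; last by nra.
by move=> i; have [? [? yp]] := xy i; rewrite (le_trans yp).
Qed.

Lemma fall_controlled_open (R : realType) (U : set R) (e : R) (g : R -> R)
    (a p q : R) : 0 <= e -> a <= p -> p <= q -> `]p, q[ `<=` U ->
  fall_controlled U e g a p -> fall_controlled U e g a q.
Proof.
move=> e0 ap pq pqU [n [x [y [xy xyU tI gap]]]].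
(* The new interval ]p, q[ is indexed by [ord0]. *)
pose cons (v : R) (z : 'I_n -> R) (i : 'I_n.+1) := oapp z v (unlift ord0 i).
have consE v z : (cons v z ord0 = v) * (forall i, cons v z (lift ord0 i) = z i).
  by rewrite /cons unlift_none; split=> // i; rewrite liftK.
exists n.+1, (cons p x), (cons q y); split.
- move=> i; case: (unliftP ord0 i) => [j|] ->; rewrite !consE//.
  by have [? [? yp]] := xy j; rewrite (le_trans yp).
- by move=> i; case: (unliftP ord0 i) => [j|] ->; rewrite !consE.
- have sep j z : `]p, q[%classic z -> `]x j, y j[%classic z -> False.
    rewrite /= !in_itv/= => /andP[pz _] /andP[_ zy].
    by have [_ [_ yp]] := xy j; move: (lt_trans pz zy); rewrite ltNge yp.
  move=> i k _ _; case: (unliftP ord0 i) => [j|] ->;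
    case: (unliftP ord0 k) => [l|] ->; rewrite ?consE// => -[z [zi zk]].
  + by congr lift; apply: tI => //; exists z.
  + by case: (sep _ _ zk zi).
  + by case: (sep _ _ zi zk).
- rewrite big_ord_recl !consE; under eq_bigr do rewrite !consE.
  have drop : g p - g q <= `|g q - g p| by rewrite distrC ler_norm.
  have slope : 0 <= e * (q - p) by rewrite mulr_ge0// subr_ge0.
  rewrite (le_trans gap)// addrA lerD2r; lra.
Qed.

(** A point outside [U] is a point of differentiability, so the slope step
applies there; a point of [U] has a neighbourhood in [U], so the other step
applies. *)
Lemma ac_nondecreasing (R : realType) (g : R -> R) (a b : R) : a <= b ->
  abs_continuous a b g ->
  (\forall t \ae (@lebesgue_measure R), a <= t <= b ->
    derivable g t 1 /\ 0 <= g^`()%classic t) ->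
  g a <= g b.
Proof.
move=> ab acg g'0; apply/ler_addgt0Pr => eta eta0.
(* One [e] pays for the variation inside [U], and [e * (b - a)] for the slope. *)
pose e := eta / (1 + (b - a)).
have ba0 : 0 <= b - a by rewrite subr_ge0.
have e0 : 0 < e by rewrite divr_gt0// ltr_wpDr.
have [d d0 acd] := acg _ e0.
have [U oU [EU Ud]] := negligible_open_cover d0 g'0.
suff [n [x [y [xy xyU tI gab]]]] : fall_controlled U e g a b.
  have sd : \sum_(i < n) (y i - x i) < d.
    rewrite -lte_fin; apply: le_lt_trans Ud; apply: sum_length_le_measure => //.
      exact: measurable_realfun.open_measurable.
    by move=> i; case: (xy i) => _ [].
  have se := acd n x y xy tI sd.
  have : eta = e * (1 + (b - a)) by rewrite divfK// gt_eqF// ltr_wpDr.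
  lra.
apply: (@real_induction _ (fall_controlled U e g a) a b ab); first exact: fall_controlled_refl.
move=> t tab; have [Ut|nUt] := pselect (U t).
- have /nbhs_ballP[r /= r0 rU] : nbhs t U by exact: open_nbhs_nbhs.
  exists r => //; split.
  + move=> p /andP[ap pt] rp; apply: fall_controlled_open => //; first exact: ltW.
    move=> z /=; rewrite in_itv/= => /andP[pz zt]; apply: rU.
    by rewrite /ball/= gtr0_norm ?subr_gt0//; lra.
  + move=> q /andP[tq qb] qr; apply: fall_controlled_open => //; first exact: ltW.
      by case/andP: tab.
    move=> z /=; rewrite in_itv/= => /andP[tz zq]; apply: rU.
    by rewrite /ball/= ltr0_norm ?subr_lt0//; lra.
- have [dg gt0] : derivable g t 1 /\ 0 <= g^`()%classic t.
    by apply: contrapT => nt; apply/nUt/EU => /(_ tab).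
  have [r r0 [leftr rightr]] := derive_ge0_almost_nondecreasing e0 dg gt0.
  exists r => //; split.
  + move=> p /andP[ap pt] rp; apply: fall_controlled_slope => //; exact: leftr.
  + move=> q /andP[tq qb] qr; apply: fall_controlled_slope => //; exact: rightr.
Qed.

Lemma abs_continuousD (R : realType) (a b : R) (u v : R -> R) :
  abs_continuous a b u -> abs_continuous a b v -> abs_continuous a b (u + v).
Proof.
move=> acu acv e e0; have e20 : 0 < e / 2 by rewrite divr_gt0.
have [du du0 hu] := acu _ e20; have [dv dv0 hv] := acv _ e20.
exists (Num.min du dv) => [|n x y xy tI]; first by rewrite lt_min du0.
rewrite lt_min => /andP[/(hu n x y xy tI) su /(hv n x y xy tI) sv].
rewrite [e]splitr; apply: le_lt_trans (ltrD su sv).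
rewrite -big_split/=; apply: ler_sum => i _.
by rewrite !fctE opprD addrACA ler_normD.
Qed.

Lemma abs_continuousZ (R : realType) (a b k : R) (u : R -> R) :
  abs_continuous a b u -> abs_continuous a b (k *: u).
Proof.
move=> acu e e0.
have k0 : 0 < `|k| + 1 by rewrite ltr_wpDl.
have [d d0 hd] := acu (e / (`|k| + 1)) (divr_gt0 e0 k0).
exists d => // n x y xy tI /(hd n x y xy tI); rewrite ltr_pdivlMr//.
apply: le_lt_trans; rewrite mulr_suml; apply: ler_sum => i _.
rewrite !fctE -scalerBr normrZ mulrC ler_wpM2l// lerDl//.
Qed.

(** * Functions on a half-line unbounded to the left *)

(** The generic instance, restated at the concrete measurable type on which
[lebesgue_measure] lives, where instance search does not find it by itself. *)
#[local] Instance lebesgue_ae_filter (R : realType) :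
  Filter (nbhs (almost_everywhere (@lebesgue_measure R))).
Proof. exact: ae_filter_ringOfSetsType. Qed.

Lemma ac_nondecreasing_ray (R : realType) (t0 : R) (g : R -> R) :
  (forall a, abs_continuous a t0 g) ->
  (\forall t \ae (@lebesgue_measure R), t <= t0 ->
    derivable g t 1 /\ 0 <= g^`()%classic t) ->
  {in `]-oo, t0] &, {homo g : x y / x <= y}}.
Proof.
move=> acg g'0 x y _; rewrite in_itv/= => yt0 xy.
apply: ac_nondecreasing => //; last first.
  by apply: filterS g'0 => t dg /andP[_ ty]; apply: dg; exact: le_trans yt0.
move=> e /(acg x)[d d0 hd]; exists d => // n p q pq; apply: hd => i.
by have [? [? qy]] := pq i; rewrite (le_trans qy).
Qed.

Lemma thetaE (R : realType) (t0 : R) (u : R -> R) :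
  theta `]-oo, t0]%classic u = fun t => u (Num.min t t0).
Proof.
apply/funext => t; rewrite /theta; have [tt0|t0t] := leP t t0.
  by rewrite mem_set//= in_itv.
rewrite memNset/= ?in_itv/=; last by rewrite leNgt t0t.
rewrite asboolF ?sup_itv//; last first.
  by move=> /(_ t0); rewrite /= in_itv/= lexx => /(_ isT); rewrite leNgt t0t.
Qed.

Lemma continuous_theta (R : realType) (t0 : R) (D : set R) (u : R -> R) :
  AC_loc `]-oo, t0]%classic D u -> C_loc (theta `]-oo, t0]%classic u).
Proof.
move=> [_ acu]; rewrite thetaE => t; apply/cvgrPdist_lt => e e0.
have [|d d0 hd] := acu (Num.min t t0 - 1) t0 _ e e0.
  by move=> z; rewrite /= !in_itv/= => /andP[].
(* Absolute continuity for a family of one interval is uniform continuity. *)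
have pair p q : Num.min t t0 - 1 <= p -> p <= q -> q <= t0 -> q - p < d ->
    `|u q - u p| < e.
  move=> ? ? ? pqd; have := hd 1%N (fun=> p) (fun=> q); rewrite !big_ord1; apply => //.
  by move=> i j _ _ _; rewrite !ord1.
apply/nbhs_ballP; exists (Num.min 1 d); first by rewrite /= lt_min ltr01.
move=> s; rewrite /ball/= lt_min => /andP[s1 sd].
have min_lip : `|Num.min t t0 - Num.min s t0| <= `|t - s|.
  have ts := ler_norm (t - s); have st : s - t <= `|t - s| by rewrite distrC ler_norm.
  by rewrite ler_norml; case: (leP t t0); case: (leP s t0); lra.
have := le_lt_trans min_lip s1; have := le_lt_trans min_lip sd.
have tt0 : Num.min t t0 <= t0 by rewrite ge_min lexx orbT.
have st0 : Num.min s t0 <= t0 by rewrite ge_min lexx orbT.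
have [le|lt] := leP (Num.min s t0) (Num.min t t0).
  rewrite ger0_norm ?subr_ge0// => ? ?; apply: pair => //; lra.
rewrite ltr0_norm ?subr_lt0// opprB distrC => ? ?; apply: pair => //; lra.
Qed.

(** The lower bound is assumed only near [-oo]: monotonicity carries it to the
whole half-line. *)
Lemma nondecreasing_cvgNy (R : realType) (t0 m : R) (g : R -> R) :
  {in `]-oo, t0] &, {homo g : x y / x <= y}} ->
  (\forall t \near -oo, m <= g t) -> exists l : R, g t @[t --> -oo] --> l.
Proof.
move=> gle [s0 [_ mg]]; pose A := [set g t | t in `]-oo, t0]%classic].
have infA : has_inf A.
  split; first by exists (g t0), t0 => //=; rewrite in_itv/=.
  exists m => _ [t /= tt0 <-].
  pose s := Num.min (s0 - 1) t.
  have st : s <= t by rewrite ge_min lexx orbT.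
  apply: (@le_trans _ _ (g s)); last first.
    by apply: gle => //; rewrite in_itv/=; apply: (le_trans st); rewrite in_itv in tt0.
  by apply: mg; apply: (@le_lt_trans _ _ (s0 - 1)); [rewrite ge_min lexx | lra].
exists (inf A); apply/cvgrPdist_lt => e e0.
have [_ [s /= st0 <-] gs] := inf_adherent e0 infA.
near=> t.
have ts : t <= s by near: t; apply: nbhs_ninfty_le; exact: num_real.
have tt0 : t \in `]-oo, t0] by rewrite in_itv/= (le_trans ts)//; rewrite in_itv in st0.
have lt : inf A <= g t by apply: ge_inf; [case: infA | exists t].
rewrite ler0_norm ?subr_le0// opprB ltrBlDl.
by apply: le_lt_trans gs; apply: gle.
Unshelve. all: by end_near. Qed.

(** * Convergence at minus infinity of the bounded solutions *)

Unset Implicit Arguments.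
Set Strict Implicit.

Theorem theorem2p7 (R : realType) (l0 l1 f : (R -> R) -> (R -> R))
  (l0_cont : continuous_operator l0) (l0_lin : linear_operator l0)
  (l0_pos : positive_operator l0)
  (l1_cont : continuous_operator l1) (l1_lin : linear_operator l1)
  (l1_pos : positive_operator l1)
  (f_cont : continuous_operator f) (f_car : local_caratheodory f)
  (t0 : R) (l1_V : V t0 l1)
  (kappa : R) (kappa_gt0 : 0 < kappa)
  (l0f_ge0 : forall v, C_0 setT `[0, kappa]%classic v ->
    \forall t \ae (@lebesgue_measure R), t <= t0 -> 0 <= l0 v t + f v t)
  (gamma_ex : exists gamma : R -> R,
    [/\ AC_loc `]-oo, t0]%classic `]0, +oo[%classic gamma,
        \forall t \ae (@lebesgue_measure R), t <= t0 ->
          derivable gamma t 1 /\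
          gamma^`()%classic t <= - l1 (theta `]-oo, t0]%classic gamma) t &
        exists2 l : \bar R, (gamma t)%:E @[t --> -oo] --> l & (l < +oo)%E]) :
  forall u : R -> R, solution l0 l1 f `]-oo, t0]%classic u ->
    (forall t, t <= t0 -> 0 <= u t <= kappa) ->
    exists l : R, u t @[t --> -oo] --> l.
Proof.
move=> u [u_ac u_eq] u_bnd.
have [gamma [gamma_ac gamma_ineq [l gamma_l l_fin]]] := gamma_ex.
have itvNy a : `[a, t0]%classic `<=` `]-oo, t0]%classic.
  by move=> z; rewrite /= !in_itv/= => /andP[].
have ray t : t <= t0 -> `]-oo, t0]%classic t by rewrite /= in_itv.
have gamma_gt0 t : t <= t0 -> 0 < gamma t.
  by move=> tt0; have := gamma_ac.1 t (ray _ tt0); rewrite /= in_itv/= andbT.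
pose U := theta `]-oo, t0]%classic u.
pose G := theta `]-oo, t0]%classic gamma.
have cU : C_loc U := continuous_theta u_ac.
have cG : C_loc G := continuous_theta gamma_ac.
have min_le t : Num.min t t0 <= t0 by rewrite ge_min lexx orbT.
have G_ge0 t : 0 <= G t by rewrite /G thetaE ltW// gamma_gt0.
have U_bnd t : 0 <= U t <= kappa by rewrite /U thetaE u_bnd.
(* [gamma' <= - l1 gamma <= 0] *)
have gamma_decr : {in `]-oo, t0] &, {homo (- gamma) : x y / x <= y}}.
  apply: ac_nondecreasing_ray => [a|].
    by rewrite -scaleN1r; apply/abs_continuousZ/gamma_ac.2/itvNy.
  apply: filterS2 (l1_pos _ cG G_ge0) gamma_ineq => t lG gam tt0.
  have [dg gle] := gam tt0; split; first exact: derivableN.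
  rewrite derive1E deriveN// -derive1E oppr_ge0 (le_trans gle)// oppr_le0//.
have gamma_ge t : t <= t0 -> gamma t0 <= gamma t.
  move=> tt0; rewrite -lerN2; have := gamma_decr t t0; apply => //; exact: ray.
(* The largest constant for which [u <= kappa] and [gamma t0 <= gamma] yield
   [k * u <= gamma]. *)
pose k := gamma t0 / kappa.
have k_gt0 : 0 < k by rewrite divr_gt0// gamma_gt0.
have Uk_le t : 0 <= - k * U t + G t.
  have : U t * k <= kappa * k by rewrite ler_pM2r//; case/andP: (U_bnd t).
  have -> : kappa * k = gamma t0 by rewrite /k mulrC divfK// gt_eqF.
  have : gamma t0 <= G t by rewrite /G thetaE gamma_ge.
  rewrite mulNr (mulrC k); lra.
have l1_ge0 : \forall t \ae (@lebesgue_measure R), 0 <= - k * l1 U t + l1 G t.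
  apply: filterS2 (l1_lin (- k) _ _ cU cG) (l1_pos _ _ Uk_le) => [t <- //|].
  move=> t; apply: cvgD; last exact: cG.
  by apply: cvgM; [exact: cvg_cst | exact: cU].
have U_C0 : C_0 setT `[0, kappa]%classic U.
  split; first exact: continuous_subspaceT.
  - exists kappa; split; first exact: num_real.
    move=> x kx t _; apply: le_trans (ltW kx).
    by case/andP: (U_bnd t) => U0 Uk; rewrite /= ger0_norm.
  - by move=> t _; rewrite /= in_itv/=.
(* [k u' - gamma' >= k (l0 u + f u) + (l1 gamma - k l1 u)] *)
have g_incr : {in `]-oo, t0] &, {homo (k *: u - gamma) : x y / x <= y}}.
  apply: ac_nondecreasing_ray => [a|].
    apply: abs_continuousD; first by apply/abs_continuousZ/u_ac.2/itvNy.
    by rewrite -scaleN1r; apply/abs_continuousZ/gamma_ac.2/itvNy.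
  apply: filterS3 (filterI u_eq gamma_ineq) (l0f_ge0 _ U_C0) l1_ge0.
  move=> t [ueq gineq] l0f l1t tt0.
  have [du u'E] := ueq (ray _ tt0); have [dg gle] := gineq tt0.
  have dku : derivable (k *: u) t 1 by exact: derivableZ.
  split; first exact: derivableB.
  rewrite derive1E deriveB// deriveZ// -!derive1E u'E /GRing.scale/= -/U.
  move: gle (l0f tt0) l1t; rewrite -/G => gle l0ft l1t.
  have : 0 <= k * (l0 U t + f U t) by rewrite mulr_ge0// ltW.
  lra.
(* Positivity of [gamma] excludes the limit [-oo]. *)
have [l' gamma_l'] : exists l', gamma t @[t --> -oo] --> (l' : R).
  case: l gamma_l l_fin => [r|//|] gamma_l _.
    by exists r; exact: (fine_cvg gamma_l).
  have neg : \forall t \near -oo, ((gamma t)%:E < 0%:E)%E.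
    by move: gamma_l => /cvgeNyPlt; exact.
  have [t [tneg tt0]] := filter_ex (filterI neg (nbhs_ninfty_le (num_real t0))).
  by move: tneg; rewrite lte_fin ltNge ltW ?gamma_gt0.
have [m g_m] : exists m, (k *: u - gamma) t @[t --> -oo] --> (m : R).
  apply: (@nondecreasing_cvgNy _ t0 (- (l' + 1))) => //.
  have : \forall t \near -oo, gamma t < l' + 1.
    by apply: (cvgr_lt _ gamma_l'); rewrite ltrDl ltr01.
  apply: filterS2 (nbhs_ninfty_le (num_real t0)) => t tt0 gl.
  rewrite !fctE; have : 0 <= k * u t.
    by apply: mulr_ge0; [exact: ltW | case/andP: (u_bnd t tt0)].
  rewrite /GRing.scale/=; lra.
exists (k^-1 * (m + l')).
have -> : u = (fun t => k^-1 * ((k *: u - gamma) t + gamma t)).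
  apply/funext => t; rewrite !fctE subrK /GRing.scale/= mulKf// gt_eqF//.
by apply: cvgM; [exact: cvg_cst | exact: cvgD].
Qed.
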